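(* There is a universal constant $C>0$ such that for every $\delta\in(0,1]$ and every $\delta$-MR configuration $V_1,V_2\subset\mathbb{C}^d$, we have $\dim(V_1\cup V_2)\le C/\delta^4$.
   Context: Let $V_1,V_2$ be two disjoint finite sets of points in $\mathbb{C}^d$; points of $V_i$ have color $i$. A line is bi-chromatic if it contains at least one point of each color. $V_1,V_2$ form a $\delta$-MR configuration if for every $i\in\{1,2\}$ and every point $p\in V_i$, the bi-chromatic lines through $p$ contain at least $\delta|V_i|$ points of $V_i$. $\dim(S)$ denotes the dimension of the smallest affine subspace containing $S$. *)

(* Defs.v *)
From mathcomp Require Import all_boot all_order all_algebra finmap.
From mathcomp Require Import boolp classical_sets reals.
From mathcomp Require Import complex.

Set Implicit Arguments.
Unset Strict Implicit.
Unset Printing Implicit Defensive.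

Import Order.TTheory GRing.Theory Num.Theory.
Local Open Scope ring_scope.

(* Points of C^d are row vectors of type 'rV[R[i]]_d, where R is a model of the
   real numbers and R[i] is its field of complex numbers. *)

(* p + W; affine subspaces are hence nonempty. *)
Definition flat (F : fieldType) (d : nat) (p : 'rV[F]_d)
    (W : {vspace 'rV[F]_d}) : set 'rV[F]_d :=
  [set x | x - p \in W]%classic.

Definition line (F : fieldType) (d : nat) (L : set 'rV[F]_d) : Prop :=
  exists (p : 'rV[F]_d) (W : {vspace 'rV[F]_d}), \dim W = 1%N /\ L = flat p W.

Definition bichromatic (F : fieldType) (d : nat) (V1 V2 : {fset 'rV[F]_d})
    (L : set 'rV[F]_d) : Prop :=
  [/\ line L, exists2 x, x \in V1 & L x & exists2 y, y \in V2 & L y].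

Definition on_bichromatic_lines (F : fieldType) (d : nat)
    (V1 V2 : {fset 'rV[F]_d}) (p : 'rV[F]_d) (V : {fset 'rV[F]_d}) :
    {fset 'rV[F]_d} :=
  [fset x in V | `[< exists L, [/\ bichromatic V1 V2 L, L p & L x] >]]%fset.

Definition MR_configuration (R : realType) (d : nat) (delta : R)
    (V1 V2 : {fset 'rV[R[i]]_d}) : Prop :=
  [/\ [disjoint V1 & V2]%fset,
      forall p, p \in V1 ->
        delta * #|` V1|%:R <= #|` on_bichromatic_lines V1 V2 p V1|%:R
    & forall p, p \in V2 ->
        delta * #|` V2|%:R <= #|` on_bichromatic_lines V1 V2 p V2|%:R].

Definition smallest_flat (F : fieldType) (d : nat) (S : set 'rV[F]_d)
    (p : 'rV[F]_d) (W : {vspace 'rV[F]_d}) : Prop :=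
  (S `<=` flat p W)%classic /\
  forall q U, (S `<=` flat q U)%classic -> (flat p W `<=` flat q U)%classic.

(* The direction W of a smallest affine subspace p + W is unique, and it exists
   for nonempty finite S (see below); affine_dim set0 = 0 by convention. *)
Definition affine_dim (F : fieldType) (d : nat) (S : set 'rV[F]_d) : nat :=
  \dim (xget 0%VS [set W | exists p, smallest_flat S p W]%classic).

Lemma smallest_flat_span (F : fieldType) (d : nat) (S : {fset 'rV[F]_d})
    (p : 'rV[F]_d) : p \in S ->
  smallest_flat [set` S]%classic p <<[seq x - p | x <- enum_fset S]>>%VS.
Proof.
move=> pS; split=> [x /= xS|q U SU x /= xW].
  by apply: memv_span; apply/mapP; exists x.
have /= pU := SU p pS.
suff /subvP/(_ _ xW) xpU : (<<[seq x - p | x <- enum_fset S]>> <= U)%VS.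
  by rewrite /flat /= -(subrK p x) -addrA memvD.
apply/span_subvP => _ /mapP[y yS ->].
by have := memvB (SU y yS) pU; rewrite opprB addrA subrK.
Qed.

Lemma smallest_flat_dir_uniq (F : fieldType) (d : nat) (S : set 'rV[F]_d)
    p q (W U : {vspace 'rV[F]_d}) :
  smallest_flat S p W -> smallest_flat S q U -> W = U.
Proof.
have sub p' q' (W' U' : {vspace 'rV[F]_d}) :
    smallest_flat S p' W' -> smallest_flat S q' U' -> (W' <= U')%VS.
  move=> [_ min1] [SU _]; have sWU := min1 _ _ SU.
  apply/subvP => w wW.
  have pU : p' - q' \in U' by apply: (sWU p'); rewrite /flat /= subrr mem0v.
  have wU : w + p' - q' \in U' by apply: (sWU (w + p')); rewrite /flat /= addrK.
  by have := memvB wU pU; rewrite -(addrA w) addrK.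
move=> h1 h2; apply/eqP; rewrite eqEsubv.
by rewrite (sub _ _ _ _ h1 h2) (sub _ _ _ _ h2 h1).
Qed.

Lemma affine_dimE (F : fieldType) (d : nat) (S : {fset 'rV[F]_d})
    (p : 'rV[F]_d) : p \in S ->
  affine_dim [set` S]%classic = \dim <<[seq x - p | x <- enum_fset S]>>%VS.
Proof.
move=> pS; have h := smallest_flat_span pS.
rewrite /affine_dim; case: xgetP => [W _ [q hq]|/(_ <<[seq x - p | x <- enum_fset S]>>%VS)].
  by rewrite (smallest_flat_dir_uniq hq h).
by case; exists p.
Qed.

(* Main.v *)
Require Import Defs.
From mathcomp Require Import all_boot all_order all_algebra finmap.
From mathcomp Require Import boolp classical_sets reals exp.
From mathcomp Require Import ring lra complex sesquilinear spectral.

(* The heart is a rank bound for collinear triples in a set of n points in which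
   every point p sees at least k points q with a third point on the line pq.
   Every ordered collinear triple on a line with r points gives a linear
   dependency, with weight 1/(r - 2), so each pair of points lies in dependencies
   of total weight at most 6.  Matrix scaling makes all weighted squared column
   norms of the matrix of dependencies at least k/4 while its rows have norm 1.  If P is
   the orthogonal projection onto the column space of the (rescaled) points, then
   the dependencies annihilate P; comparing the diagonal and the off-diagonal
   part of the resulting trace identity gives k^2 rank <= 96 n^2.

   For a configuration with |V2| <= |V1|: if |V2| is at least (delta/4) |V1|, the
   bound applies to the union with k of order delta |V2|.  Otherwise, for
   each point p of V1, most points of V1 on bichromatic lines through p lie on
   lines with three points of V1, so the bound applies to V1 alone, and V2 adds at
   most 1/delta dimensions. *)

Import Order.TTheory GRing.Theory Num.Theory.
Local Open Scope ring_scope.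
Set Implicit Arguments.
Unset Strict Implicit.
Unset Printing Implicit Defensive.

(** * Matrix scaling through a logarithmic potential *)

Section Scaling.
Variables (R : realType) (I J : finType).
Variables (A : I -> J -> R) (p : I -> J) (w : I -> R) (k : R).
Hypothesis A_ge0 : forall r j, 0 <= A r j.
Hypothesis Ap_gt0 : forall r, 0 < A r (p r).
Hypothesis w_ge0 : forall r, 0 <= w r.
Hypothesis k_gt0 : 0 < k.
Let K j : R := \sum_(r | p r == j) w r.
Hypothesis k_le : forall j, k <= K j.

Let N (c : J -> R) r := \sum_j A r j * c j.
(** The derivative of [phi] in [ln (c j)] is the [j]-th weighted column sum of the scaled matrix
    minus [K j], so near-minimality forces large column sums. *)
Let phi (c : J -> R) := \sum_r w r * ln (N c r) - \sum_j K j * ln (c j).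

Let N_ge (c : J -> R) r : (forall j, 0 < c j) -> A r (p r) * c (p r) <= N c r.
Proof.
move=> c0; rewrite /N (bigD1 (p r)) //= lerDl sumr_ge0 // => j _.
by rewrite mulr_ge0 // ltW.
Qed.

Let N_gt0 (c : J -> R) r : (forall j, 0 < c j) -> 0 < N c r.
Proof. by move=> c0; apply: lt_le_trans (N_ge r c0); rewrite mulr_gt0. Qed.

(** Only the pivot entry [p r] of each row is kept; grouping the rows by pivot then cancels the
    terms [ln (c j)]. *)
Let phi_lb (c : J -> R) : (forall j, 0 < c j) ->
  \sum_r w r * ln (A r (p r)) <= phi c.
Proof.
move=> c0; rewrite /phi lerBrDr.
have -> : \sum_j K j * ln (c j) = \sum_r w r * ln (c (p r)).
  rewrite [RHS](partition_big p xpredT) //=; apply: eq_bigr => j _.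
  by rewrite mulr_suml; apply: eq_bigr => r /eqP ->.
rewrite -big_split /=; apply: ler_sum => r _; rewrite -mulrDr ler_wpM2l //.
by rewrite -lnM ?posrE // ler_ln ?posrE ?mulr_gt0 ?N_gt0 // N_ge.
Qed.

Let double (c : J -> R) j i := if i == j then 2 * c j else c i.

Let double_gt0 (c : J -> R) j : (forall i, 0 < c i) -> forall i, 0 < double c j i.
Proof. by move=> c0 i; rewrite /double; case: eqP => // _; rewrite mulr_gt0. Qed.

Let N_double (c : J -> R) j r : N (double c j) r = N c r + A r j * c j.
Proof.
rewrite /N (bigD1 j) //= [in RHS](bigD1 j) //= {1}/double eqxx.
rewrite (eq_bigr (fun i => A r i * c i)); first by ring.
by move=> i /negPf ij; rewrite /double ij.
Qed.

Let ln2_ge : 1 / 2 <= ln (2 : R).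
Proof.
have := @le_ln1Dx R (- (1 / 2)); rewrite (_ : 1 - 1 / 2 = 2^-1); last by field.
by rewrite lnV ?posrE // => /(_ _)/[!lerN2]; apply; lra.
Qed.

(* With ln 2 >= 1/2, doubling c j changes phi by at most
   s_j - K j / 2, where s_j is the j-th column sum of the scaled matrix. *)
Let phi_double (c : J -> R) j : (forall i, 0 < c i) ->
  phi (double c j) <= phi c + \sum_r w r * (A r j * c j / N c r) - K j / 2.
Proof.
move=> c0; rewrite /phi.
have -> : \sum_i K i * ln (double c j i) = \sum_i K i * ln (c i) + K j * ln 2.
  rewrite (bigD1 j) //= [in RHS](bigD1 j) //= {1}/double eqxx lnM ?posrE //.
  rewrite (eq_bigr (fun i => K i * ln (c i))); first by ring.
  by move=> i /negPf ij; rewrite /double ij.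
have le1 : \sum_r w r * ln (N (double c j) r) <=
    \sum_r w r * ln (N c r) + \sum_r w r * (A r j * c j / N c r).
  rewrite -big_split /=; apply: ler_sum => r _; rewrite -mulrDr ler_wpM2l //.
  have N0 := N_gt0 r c0; have x0 : 0 <= A r j * c j / N c r.
    by rewrite divr_ge0 ?mulr_ge0 // ltW.
  have -> : N (double c j) r = N c r * (1 + A r j * c j / N c r).
    by rewrite N_double; field; rewrite gt_eqF.
  by rewrite lnM ?posrE ?lerD2l ?le_ln1Dx //; lra.
have le2 : K j / 2 <= K j * ln 2.
  rewrite ler_wpM2l //; first by rewrite (le_trans (ltW k_gt0)).
  by rewrite -div1r.
by lra.
Qed.

(** An approximate minimiser suffices: if [phi c] is within [k / 4] of the infimum, a column sum
    below [k / 4] would let the doubling of [c j] bring [phi] below the infimum, because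
    [K j / 2 >= k / 2]. *)
Lemma column_scaling : exists c : J -> R, (forall j, 0 < c j) /\
  forall j, k / 4 <= \sum_r w r * (A r j * c j / \sum_i A r i * c i).
Proof.
pose E : set R := [set x | exists2 c, (forall j, 0 < c j) & x = phi c]%classic.
have infE : has_inf E.
  split; first by exists (phi (fun=> 1)), (fun=> 1).
  by exists (\sum_r w r * ln (A r (p r))) => _ [c c0 ->]; apply: phi_lb.
have k4 : 0 < k / 4 by rewrite divr_gt0.
have [_ [c c0 ->] lt_c] := inf_adherent k4 infE.
exists c; split=> // j; rewrite leNgt; apply/negP => lt_s.
have : inf E <= phi (double c j).
  apply: ge_inf; first exact: infE.2.
  by exists (double c j) => //; apply: double_gt0.
have := phi_double j c0; have := k_le j; rewrite /N in lt_s *; lra.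
Qed.

End Scaling.

(** * Trace inequality: diagonal against off-diagonal part *)

(* For an orthogonal projection P onto a space annihilated by vectors b r, take
   a i j = |P i j|, d i = P i i and f r i = |b r i|. *)
Section TraceBound.
Variables (R : realFieldType) (n : nat) (I : finType).
Variables (a : 'I_n -> 'I_n -> R) (d : 'I_n -> R) (f : I -> 'I_n -> R).
Variables (w : I -> R) (k T : R).
Hypothesis w_ge0 : forall r, 0 <= w r.
Hypothesis k_gt0 : 0 < k.
Hypothesis T_gt0 : 0 < T.
Hypothesis dE : forall i, d i = \sum_j a i j ^+ 2.
Hypothesis le_d : forall r i,
  d i * f r i ^+ 2 <= \sum_(j | j != i) a i j * f r i * f r j.
Let N r := \sum_i f r i ^+ 2.
Hypothesis N_gt0 : forall r, 0 < N r.
Hypothesis le_T : forall i j, i != j ->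
  \sum_(r | (f r i != 0) && (f r j != 0)) w r <= T.
Hypothesis k_le : forall i, k <= \sum_r w r * (f r i ^+ 2 / N r).

(** Summing [le_d] with weights [w r / N r] bounds [k * D] by an off-diagonal sum. AM-GM splits that
    sum into a part controlled by [le_T] and a part controlled by the norm of [y r]. *)
Lemma trace_bound : k ^+ 2 * \sum_i d i <= T * \sum_r w r.
Proof.
(* This [t] makes the bound on the first AM-GM part equal to half of [k * D], which the left side
   absorbs. *)
pose D := \sum_i d i; pose t := k / T.
have t_gt0 : 0 < t by rewrite divr_gt0.
pose y r i j := f r i * f r j / N r.
have d_ge0 i : 0 <= d i by rewrite dE sumr_ge0 // => j _; rewrite sqr_ge0.
have y_le1 r : \sum_i \sum_j y r i j ^+ 2 <= 1.
  rewrite (eq_bigr (fun i => f r i ^+ 2 / N r)).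
    by rewrite -mulr_suml divff // -/(N r) gt_eqF.
  move=> i _; rewrite (eq_bigr (fun j => (f r i ^+ 2 / N r ^+ 2) * f r j ^+ 2)).
    by rewrite -mulr_sumr -/(N r); field; apply: lt0r_neq0.
  by move=> j _; rewrite /y; field; rewrite gt_eqF.
have le1 : k * D <= \sum_r \sum_i \sum_(j | j != i) w r * (y r i j * a i j).
  apply: (@le_trans _ _ (\sum_i d i * \sum_r w r * (f r i ^+ 2 / N r))).
    by rewrite mulr_sumr; apply: ler_sum => i _; rewrite mulrC ler_wpM2l.
  rewrite (eq_bigr (fun i => \sum_r w r * ((d i * f r i ^+ 2) / N r))); last first.
    by move=> i _; rewrite mulr_sumr; apply: eq_bigr => r _; ring.
  rewrite exchange_big /=; apply: ler_sum => r _; apply: ler_sum => i _.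
  rewrite -mulr_sumr ler_wpM2l // ler_pdivrMr //.
  rewrite (le_trans (le_d r i)) // mulr_suml; apply: ler_sum => j _.
  by rewrite /y le_eqVlt; apply/orP; left; apply/eqP; field; rewrite gt_eqF.
(* On the common support the gap is [w r / (2 * t)] times the square of [t * a i j - y r i j];
   elsewhere [y r i j] is zero. *)
have le2 r i j : w r * (y r i j * a i j) <=
    t / 2 * (a i j ^+ 2 * (if (f r i != 0) && (f r j != 0) then w r else 0))
    + w r / (2 * t) * y r i j ^+ 2.
  have [yn0|] := boolP ((f r i != 0) && (f r j != 0)); last first.
    rewrite negb_and !negbK => yn0; have -> : y r i j = 0.
      by case/orP: yn0 => /eqP e; rewrite /y e ?mulr0 !mul0r.
    by rewrite expr0n /= !(mul0r, mulr0) addr0.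
  have := mulr_ge0 (w_ge0 r) (divr_ge0 (sqr_ge0 (t * a i j - y r i j)) (ltW t_gt0)).
  move=> h; rewrite -subr_ge0.
  rewrite [leRHS](_ : _ = w r * ((t * a i j - y r i j) ^+ 2 / t) / 2).
    by rewrite divr_ge0.
  by field; rewrite gt_eqF.
have le3 : k * D <= t / 2 * (T * D) + (\sum_r w r) / (2 * t).
  apply: (le_trans le1); pose u r i j : R := if (f r i != 0) && (f r j != 0) then w r else 0.
  have h1 : \sum_r \sum_i \sum_(j | j != i) t / 2 * (a i j ^+ 2 * u r i j)
      <= t / 2 * (T * D).
    have -> : t / 2 * (T * D) = \sum_i \sum_j t / 2 * (T * a i j ^+ 2).
      by rewrite /D !mulr_sumr; apply: eq_bigr => i _; rewrite dE !mulr_sumr.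
    rewrite exchange_big; apply: ler_sum => i _; rewrite exchange_big /=.
    rewrite [leRHS](bigID (fun j => j != i)) /= -[leLHS]addr0 lerD //; last first.
      rewrite sumr_ge0 // => j _; apply: mulr_ge0; first by rewrite divr_ge0 // ltW.
      by apply: mulr_ge0 (ltW T_gt0) (sqr_ge0 _).
    apply: ler_sum => j ij; rewrite -mulr_sumr -mulr_sumr.
    apply: ler_wpM2l; first by rewrite divr_ge0 // ltW.
    rewrite [leLHS]mulrC; apply: ler_wpM2r; first exact: sqr_ge0.
    by rewrite -big_mkcond /= le_T // eq_sym.
  have h2 : \sum_r \sum_i \sum_(j | j != i) w r / (2 * t) * y r i j ^+ 2
      <= (\sum_r w r) / (2 * t).
    rewrite mulr_suml; apply: ler_sum => r _.
    have wt : 0 <= w r / (2 * t) by rewrite divr_ge0 // mulr_ge0 // ltW.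
    apply: (@le_trans _ _ (w r / (2 * t) * \sum_i \sum_j y r i j ^+ 2)).
      rewrite mulr_sumr; apply: ler_sum => i _; rewrite -mulr_sumr ler_wpM2l //.
      by rewrite [leRHS](bigID (fun j => j != i)) /= lerDl sumr_ge0 // => j _; apply: sqr_ge0.
    by rewrite -[leRHS]mulr1 ler_wpM2l.
  apply: le_trans (lerD h1 h2).
  rewrite -big_split; apply: ler_sum => r _; rewrite -big_split.
  apply: ler_sum => i _; rewrite -big_split; apply: ler_sum => j _.
  exact: le2.
have tT : t / 2 * (T * D) = k * D / 2 by rewrite /t; field; rewrite gt_eqF.
have -> : T * \sum_r w r = 2 * k * ((\sum_r w r) / (2 * t)).
  by rewrite /t; field; rewrite !gt_eqF.
have -> : k ^+ 2 * D = 2 * k * (k * D / 2) by field.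
apply: ler_wpM2l; first by rewrite mulr_ge0 // ltW.
by rewrite tT in le3; lra.
Qed.
End TraceBound.

(** * Rank bound from weighted sparse dependencies over the complex numbers *)

Section DesignRank.
Local Open Scope sesquilinear_scope.

(** Gram-Schmidt on a row basis gives [Z] with orthonormal rows, and its adjoint times [Z] is the
    projector. It kills the kernel of [Y] because [Z] is a left multiple of [Y]. *)
Lemma row_space_projector (C : numClosedFieldType) m n (Y : 'M[C]_(m, n)) :
  exists P : 'M[C]_n, [/\ P ^t* = P, P *m P = P, \tr P = (\rank Y)%:R &
    forall v : 'cV_n, Y *m v = 0 -> P *m v = 0].
Proof.
pose Z := schmidt (row_base Y).
have Zu : Z *m Z ^t* = 1%:M by apply/unitarymxP/schmidt_unitarymx/rank_leq_col.
have ZY : (Z <= Y)%MS by rewrite eqmx_schmidt_free ?row_base_free ?eq_row_base.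
exists (Z ^t* *m Z); split.
- rewrite trmx_mul map_mxM; congr (_ *m _).
  by apply/matrixP => i j; rewrite !mxE /= conjCK.
- by rewrite mulmxA -(mulmxA _ Z) Zu mulmx1.
- by rewrite mxtrace_mulC Zu mxtrace1.
- move=> v Yv; have /submxP[M ->] := ZY.
  by rewrite -!mulmxA Yv !mulmx0.
Qed.

Variable R : realType.
Local Notation C := R[i].
Local Notation nrm := ComplexField.Normc.normc.

Let nrmE (x : C) : `|x| = (nrm x)%:C%C. Proof. by []. Qed.

Let nrm_ge0 (x : C) : 0 <= nrm x.
Proof. by rewrite -lecR -nrmE normr_ge0. Qed.

Let nrm_eq0 (x : C) : (nrm x == 0) = (x == 0).
Proof. by rewrite -(inj_eq (@complexI R)) -nrmE normr_eq0. Qed.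

(** Scaling the coefficients by [e] and the points by its inverse keeps the dependencies without
    lowering the rank. The factor 16 comes from the column bound [k / 4], squared in
    [trace_bound]. *)
Lemma design_rank n d (I : finType) (p : I -> 'I_n) (w : I -> R)
    (alpha : I -> 'I_n -> C) (X : 'M[C]_(n, d)) (k T : R) :
  0 < k -> 0 < T -> (forall r, 0 <= w r) -> (forall r, alpha r (p r) != 0) ->
  (forall j, k <= \sum_(r | p r == j) w r) ->
  (forall i j, i != j ->
    \sum_(r | (alpha r i != 0) && (alpha r j != 0)) w r <= T) ->
  (forall r, \sum_i alpha r i *: row i X = 0) ->
  k ^+ 2 * (\rank X)%:R <= 16 * T * \sum_r w r.
Proof.
move=> k0 T0 w0 ap kK TT aX.
have [||c [c0 cs]] := @column_scaling R I 'I_n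
  (fun r j => nrm (alpha r j) ^+ 2) p w k _ _ w0 k0 kK.
- by move=> r j; rewrite sqr_ge0.
- by move=> r; rewrite exprn_gt0 // lt_def nrm_ge0 nrm_eq0 ap.
(* A square root, because [column_scaling] was applied to squared moduli. *)
pose e j := Num.sqrt (c j).
have e0 j : 0 < e j by rewrite sqrtr_gt0.
pose b r j : C := alpha r j * (e j)%:C%C.
have nb r j : nrm (b r j) ^+ 2 = nrm (alpha r j) ^+ 2 * c j.
  rewrite ComplexField.Normc.normcM exprMn; congr (_ * _).
  by rewrite /= expr0n addr0 sqrtr_sqr ger0_norm ?ltW // sqr_sqrtr // ltW.
have b_eq0 r j : (nrm (b r j) != 0) = (alpha r j != 0).
  by rewrite nrm_eq0 mulf_eq0 negb_or (inj_eq (@complexI R) _ 0) (gt_eqF (e0 j)) andbT.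
pose Y := diag_mx (\row_j ((e j)^-1)%:C%C) *m X.
have YE i j : Y i j = ((e i)^-1)%:C%C * X i j by rewrite /Y mul_diag_mx !mxE.
have rankY : (\rank X <= \rank Y^T)%N.
  have -> : X = diag_mx (\row_j (e j)%:C%C) *m Y.
    apply/matrixP => i j; rewrite /Y !mul_diag_mx !mxE mulrA -rmorphM /=.
    by rewrite divff ?gt_eqF // mul1r.
  by rewrite mxrank_tr mxrankM_maxr.
have [P [Ph PP trP kerP]] := row_space_projector Y^T.
have Pb r i : \sum_j P i j * b r j = 0.
  have /kerP/colP/(_ i) : Y^T *m (\col_j b r j) = 0.
    apply/colP => j; rewrite !mxE.
    transitivity ((\sum_i alpha r i *: row i X) 0 j); last by rewrite aX mxE.
    rewrite summxE; apply: eq_bigr => l _.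
    rewrite [Y^T _ _]mxE YE [in LHS]mxE [in RHS]mxE [in RHS]mxE /b.
    rewrite mulrC -!mulrA; congr (_ * _); rewrite mulrA -rmorphM /=.
    by rewrite divff ?gt_eqF // mul1r.
  by rewrite !mxE; under eq_bigr => j _ do rewrite mxE.
pose a i j := nrm (P i j); pose dd i := \sum_j a i j ^+ 2.
(* As [P] is Hermitian and idempotent, its diagonal entries are squared row norms. *)
have Pd i : P i i = (dd i)%:C%C.
  rewrite -[in LHS]PP mxE /dd rmorph_sum; apply: eq_bigr => j _.
  rewrite rmorphXn /= -nrmE sqr_normc; congr (_ * _).
  by rewrite -[in LHS]Ph !mxE.
have sumd : \sum_i dd i = (\rank Y^T)%:R.
  apply: (@complexI R); rewrite rmorph_sum rmorph_nat -trP.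
  by apply: eq_bigr => i _; apply/esym/Pd.
have dd0 i : 0 <= dd i by rewrite sumr_ge0 // => j _; rewrite sqr_ge0.
have ddE i : dd i = \sum_j a i j ^+ 2 by []; clearbody dd.
have le_d r i : dd i * nrm (b r i) ^+ 2 <=
    \sum_(j | j != i) a i j * nrm (b r i) * nrm (b r j).
  have : dd i * nrm (b r i) <= \sum_(j | j != i) a i j * nrm (b r j).
    rewrite -lecR rmorphM rmorph_sum /= -nrmE -(ger0_norm (dd0 i)).
    have /eqP := Pb r i; rewrite (bigD1 i) //= addr_eq0 Pd => /eqP Pbi.
    have -> : (`|dd i|)%:C%C = `|(dd i)%:C%C| :> C.
      by rewrite nrmE /= expr0n addr0 sqrtr_sqr.
    rewrite -normrM Pbi normrN; apply: le_trans (ler_norm_sum _ _ _) _.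
    by apply: ler_sum => j _; rewrite normrM rmorphM.
  move=> /(ler_wpM2l (nrm_ge0 (b r i))).
  rewrite mulr_sumr [leLHS](_ : _ = dd i * nrm (b r i) ^+ 2); last by ring.
  by under eq_bigr => j _ do rewrite mulrCA mulrA.
have N0 r : 0 < \sum_i nrm (b r i) ^+ 2.
  rewrite (bigD1 (p r)) //= ltr_pwDl ?sumr_ge0 // => [|j _]; last exact: sqr_ge0.
  by rewrite exprn_gt0 // lt_def nrm_ge0 b_eq0 ap.
have leT i j : i != j ->
    \sum_(r | (nrm (b r i) != 0) && (nrm (b r j) != 0)) w r <= T.
  by move=> ij; under eq_bigl => r do rewrite !b_eq0; apply: TT.
have lek i : k / 4 <= \sum_r w r * (nrm (b r i) ^+ 2 / \sum_j nrm (b r j) ^+ 2).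
  by under eq_bigr => r _ do (rewrite nb; under eq_bigr => j _ do rewrite nb).
have k4 : 0 < k / 4 by rewrite divr_gt0.
have := trace_bound w0 k4 T0 ddE le_d N0 leT lek; rewrite sumd.
have : k ^+ 2 * (\rank X)%:R <= k ^+ 2 * (\rank Y^T)%:R.
  by rewrite ler_wpM2l ?sqr_ge0 // ler_nat.
by lra.
Qed.
End DesignRank.

(** * Lines through indexed points and dependencies of collinear triples *)

Section CollinearTriples.
Variables (F : fieldType) (n d : nat) (x : 'I_n -> 'rV[F]_d).
Hypothesis x_inj : injective x.

Definition on_line (i j : 'I_n) : {set 'I_n} :=
  [set l | x l - x i \in <[x j - x i]>%VS].

Lemma on_line_l i j : i \in on_line i j.
Proof. by rewrite inE subrr mem0v. Qed.

Lemma on_line_r i j : j \in on_line i j.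
Proof. by rewrite inE memv_line. Qed.

Lemma on_line_eq i j a b : a != b -> a \in on_line i j -> b \in on_line i j ->
  on_line a b = on_line i j.
Proof.
rewrite !inE => ab /vlineP[s es] /vlineP[t et].
have eb : x b - x a = (t - s) *: (x j - x i).
  by rewrite scalerBl -et -es opprB addrA subrK.
have ts : t - s != 0.
  apply: contraNneq ab => ts0; move: eb; rewrite ts0 scale0r => /eqP.
  by rewrite subr_eq0 => /eqP/x_inj ->.
have -> : on_line a b = [set l | x l - x a \in <[x j - x i]>%VS].
  apply/setP => l; rewrite !inE eb; apply/vlineP/vlineP => -[c ->].
    by exists (c * (t - s)); rewrite scalerA.
  by exists (c / (t - s)); rewrite scalerA divfK.
apply/setP => l; rewrite !inE.
have -> : x l - x a = x l - x i - s *: (x j - x i).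
  by rewrite -es opprB addrA subrK.
by rewrite rpredBr ?memvZ // memv_line.
Qed.

Let sum_delta (V : lmodType F) (f : 'I_n -> V) l : \sum_m (m == l)%:R *: f m = f l.
Proof.
rewrite (bigD1 l) //= eqxx scale1r big1 ?addr0 // => m /negPf ->.
by rewrite scale0r.
Qed.

(** Writing [x l] as [t *: x j + (1 - t) *: x i] gives the coefficients; distinctness excludes
    [t = 0] and [t = 1]. Their zero sum makes the dependency invariant under translation. *)
Lemma collinear_dependency i j l : i != j -> l != i -> l != j ->
    l \in on_line i j ->
  exists y : 'I_n -> F, [/\ forall m, (y m != 0) = [|| m == i, m == j | m == l],
    \sum_m y m = 0 & \sum_m y m *: x m = 0].
Proof.
rewrite inE => ij li lj /vlineP[t et].
have el : x l = t *: x j + (1 - t) *: x i.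
  by rewrite -(subrK (x i) (x l)) et scalerBr scalerBl scale1r addrAC addrA.
have t0 : t != 0.
  by apply: contraNneq li => t0; apply/eqP/x_inj; rewrite el t0 scale0r add0r subr0 scale1r.
have t1 : 1 - t != 0.
  apply: contraNneq lj => t1; apply/eqP/x_inj; rewrite el t1 scale0r addr0.
  by rewrite -[t](subKr 1) t1 subr0 scale1r.
pose y m : F := (m == l)%:R - t * (m == j)%:R - (1 - t) * (m == i)%:R.
exists y; split.
- move=> m; rewrite /y.
  have [->|mi] := eqVneq m i.
    by rewrite [i == l]eq_sym (negPf li) (negPf ij) mulr0 subr0 sub0r mulr1 oppr_eq0 t1.
  have [->|mj] := eqVneq m j.
    by rewrite [j == l]eq_sym (negPf lj) mulr1 mulr0 subr0 sub0r oppr_eq0 t0.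
  by rewrite !mulr0 !subr0; case: (m == l); rewrite ?oner_eq0 ?eqxx.
- transitivity (\sum_m y m *: (1 : F^o)).
    by apply: eq_bigr => m _; rewrite /GRing.scale /= mulr1.
  under eq_bigr => m _ do rewrite !scalerBl -!scalerA.
  rewrite !sumrB -!scaler_sumr !sum_delta /GRing.scale /= !mulr1; ring.
- under eq_bigr => m _ do rewrite !scalerBl -!scalerA.
  by rewrite !sumrB -!scaler_sumr !sum_delta el -addrA -opprD subrr.
Qed.

Definition third_points (i j : 'I_n) : {set 'I_n} := on_line i j :\ i :\ j.

Lemma card_third_points i j : i != j -> #|third_points i j| = (#|on_line i j| - 2)%N.
Proof.
move=> ij; rewrite [in RHS](cardsD1 i) on_line_l (cardsD1 j (_ :\ i)).
by rewrite in_setD1 eq_sym ij on_line_r addnA addKn.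
Qed.

End CollinearTriples.

(** * A quantitative Sylvester-Gallai bound *)

Section SylvesterGallai.
Variables (R : realType) (n d : nat) (x : 'I_n -> 'rV[R[i]]_d).
Hypothesis x_inj : injective x.
Local Notation L := (on_line x).

Let triple : pred ('I_n * 'I_n * 'I_n) :=
  fun t => let: (i, j, l) := t in [&& i != j, l != i, l != j & l \in L i j].
Let I : finType := {t | t \in triple}.
Local Notation third := (third_points x).
(** Normalised so that the triples extending an ordered pair [(i, j)] have total weight 1 as soon as
    there is one. *)
Let w0 (i j : 'I_n) : R := (#|third i j|%:R)^-1.
Let p (r : I) : 'I_n := (val r).1.1.
Let w (r : I) : R := w0 (val r).1.1 (val r).1.2.

Let in_triple i j l : ((i, j, l) \in triple) = (i != j) && (l \in third i j).
Proof. by rewrite unfold_in /= !inE; case: (l == i); case: (l == j). Qed.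

Let weight_at i : \sum_(r | p r == i) w r =
  #|[set j | (j != i) && (third i j != finset.set0)]|%:R.
Proof.
rewrite /w /p -(big_sub_cond (mem triple) (fun t => t.1.1 == i) (fun t => w0 t.1.1 t.1.2)) /=.
rewrite (eq_bigl (fun t : 'I_n * 'I_n * 'I_n => (t.1.1 == i) &&
  (t.1.1 != t.1.2) && (t.2 \in third t.1.1 t.1.2))); last first.
  by case=> [[a b] l] /=; rewrite in_triple andbC andbA.
rewrite -(pair_big_dep (fun s : 'I_n * 'I_n => (s.1 == i) && (s.1 != s.2))
  (fun s l => l \in third s.1 s.2) (fun s _ => w0 s.1 s.2)) /=.
rewrite -(pair_big_dep (fun a => a == i) (fun a b => a != b)
  (fun a b => \sum_(l in third a b) w0 a b)) /= big_pred1_eq.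
rewrite (bigID (fun j => third i j != finset.set0)) /= [X in _ + X]big1 ?addr0; last first.
  by move=> j /andP[_ /negPn/eqP->]; rewrite big_set0.
rewrite (eq_bigr (fun=> 1)) => [|j /andP[_ Lj]]; last first.
  by rewrite sumr_const -mulr_natl /w0 divff // pnatr_eq0 cards_eq0.
rewrite sumr_const; congr (_%:R); apply: eq_card => j.
by rewrite !inE eq_sym.
Qed.

(** All these triples lie on the line through [i] and [j]. If it has [r] points, the remaining index
    takes [r - 2] values, in at most six orders each, and every triple weighs [1 / (r - 2)]. *)
Let pair_weight i j (S : pred I) : i != j ->
    (forall r, S r -> [&& i \in [:: (val r).1.1; (val r).1.2; (val r).2]
                  & j \in [:: (val r).1.1; (val r).1.2; (val r).2]]) ->
  \sum_(r | S r) w r <= 6.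
Proof.
move=> ij Sij.
pose six m := [:: (i, j, m); (j, i, m); (i, m, j); (j, m, i); (m, i, j); (m, j, i)].
have lineE (r : I) : S r -> L i j = L (val r).1.1 (val r).1.2.
  case: r => [[[a b] l] abl] Sr; have /and4P[ab la lb labL] := abl.
  have sub m : m \in [:: a; b; l] -> m \in L a b.
    by rewrite [_ \in [:: _; _; _]]inE !in_cons in_nil orbF => /or3P[]/eqP->;
      rewrite ?on_line_l ?on_line_r.
  by have /andP[/sub iL /sub jL] := Sij _ Sr; apply: on_line_eq.
have wE (r : I) : S r -> w r = w0 i j.
  move=> Sr; have := lineE r Sr; rewrite /w /w0 !card_third_points //; first by move->.
  by case: r {Sr} => [[[a b] l] abl] /=; have /and4P[] := abl.
have covered (r : I) : S r -> exists2 m, m \in third i j & val r \in six m.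
  move=> Sr; have := lineE r Sr; have := Sij r Sr.
  case: r {Sr} => [[[a b] l] abl] /=; have /and4P[ab la lb labL] := abl.
  (* Of the nine pairs of positions of [i] and [j], three contradict [i != j]; in the other six the
     witness is the remaining entry. *)
  rewrite /third_points /six => /andP[+ +] ->; rewrite !inE => /or3P[]/eqP ei /or3P[]/eqP ej;
    move: ij; rewrite ei ej ?eqxx // => _;
    [exists l|exists b|exists l|exists a|exists b|exists a];
    rewrite ?in_setD1 ?lb ?la ?labL ?on_line_l ?on_line_r ?inE ?eqxx ?orbT ?ab
      ?[b == a]eq_sym ?[a == l]eq_sym ?[b == l]eq_sym ?lb ?la ?ab //.
have card_six m : (#|[pred r : I | val r \in six m]| <= 6)%N.
  rewrite -(card_imset _ val_inj); apply: (@leq_trans #|mem (six m)|); last exact: card_size.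
  by apply/subset_leq_card/fintype.subsetP => _ /imsetP[r + ->].
apply: (@le_trans _ _ (\sum_r \sum_(m in third i j) (val r \in six m)%:R * w0 i j)).
  rewrite [leRHS](bigID S) /= -[leLHS]addr0; apply: lerD; last first.
    by do 2![apply: sumr_ge0 => ? _]; rewrite mulr_ge0 ?ler0n ?invr_ge0 ?ler0n.
  apply: ler_sum => r Sr; have [m mij rm] := covered r Sr.
  rewrite (bigD1 m) //= rm mul1r wE // lerDl.
  by apply: sumr_ge0 => ? _; rewrite mulr_ge0 ?ler0n ?invr_ge0 ?ler0n.
rewrite exchange_big /=.
apply: (@le_trans _ _ (\sum_(m in third i j) 6 * w0 i j)).
  apply: ler_sum => m _; rewrite -mulr_suml ler_wpM2r ?invr_ge0 ?ler0n //.
  rewrite -natr_sum ler_nat (leq_trans _ (card_six m)) // -sum1_card [leqRHS]big_mkcond.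
  by apply: leq_sum => r _; rewrite inE; case: (val r \in six m).
rewrite sumr_const /w0 -[leLHS]mulr_natl mulrCA.
have [->|c0] := eqVneq (#|third i j|) 0; first by rewrite mul0r mulr0.
by rewrite divff ?mulr1 // pnatr_eq0.
Qed.

(** Here 96 is [16 * 6], from [design_rank] with [T = 6]; the total weight is at most [n ^ 2], since
    each first index carries at most [n]. *)
Lemma sylvester_gallai_rank (p0 : 'rV[R[i]]_d) (k : R) : 0 < k ->
  (forall i, k <= #|[set j | (j != i) && (third i j != finset.set0)]|%:R) ->
  k ^+ 2 * (\rank (\matrix_i (x i - p0)))%:R <= 96 * n%:R ^+ 2.
Proof.
move=> k0 kK.
have triple_r (r : I) : [/\ p r != (val r).1.2, (val r).2 != p r,
    (val r).2 != (val r).1.2 & (val r).2 \in L (p r) (val r).1.2].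
  by case: r => [[[a b] l] /= abl]; apply/and4P.
have dependency (r : I) : exists y : 'I_n -> R[i],
    [/\ forall m, (y m != 0) = [|| m == p r, m == (val r).1.2 | m == (val r).2],
    \sum_m y m = 0 & \sum_m y m *: x m = 0].
  by have [*] := triple_r r; apply: collinear_dependency.
have [alpha alphaP] := fin_all_exists dependency.
have w_ge0 r : 0 <= w r by rewrite invr_ge0 ler0n.
have kK' i : k <= \sum_(r | p r == i) w r by rewrite weight_at.
have ap r : alpha r (p r) != 0 by have [-> _ _] := alphaP r; rewrite eqxx.
have aX r : \sum_m alpha r m *: row m (\matrix_i (x i - p0)) = 0.
  have [_ s0 sx] := alphaP r.
  under eq_bigr => m _ do rewrite rowK scalerBr.
  by rewrite sumrB sx -scaler_suml s0 scale0r subrr.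
have T6 i j : i != j ->
    \sum_(r | (alpha r i != 0) && (alpha r j != 0)) w r <= 6.
  move=> ij; apply: (pair_weight ij) => r; have [aE _ _] := alphaP r.
  by rewrite !aE !inE.
apply: le_trans (design_rank k0 _ w_ge0 ap kK' T6 aX) _ => //.
have -> : 96 * n%:R ^+ 2 = 16 * 6 * n%:R ^+ 2 :> R by ring.
apply: ler_wpM2l; first by rewrite mulr_ge0.
rewrite (partition_big p xpredT) //= (eq_bigr _ (fun i _ => weight_at i)).
apply: (@le_trans _ _ (\sum_(i < n) n%:R)); last first.
  by rewrite sumr_const card_ord -[leLHS]mulr_natl expr2.
by apply: ler_sum => i _; rewrite ler_nat -[leqRHS]card_ord max_card.
Qed.
End SylvesterGallai.

(** * From indexed families to spans of finite sets *)

Lemma dim_span_le_rank (F : fieldType) n d (X : n.-tuple 'rV[F]_d) :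
  (\dim <<X>> <= \rank (\matrix_i tnth X i))%N.
Proof.
pose b := vbasis <<X>>%VS; pose B : 'M_(_, d) := \matrix_i tnth b i.
have /eqP <- : row_free B.
  apply: inj_row_free => v; rewrite mulmx_sum_row => vB; apply/rowP => i.
  rewrite mxE; have /freeP fb := basis_free (vbasisP <<X>>%VS); apply: (fb (fun i => v 0 i)).
  by rewrite -[RHS]vB; apply: eq_bigr => j _; rewrite rowK (tnth_nth 0).
apply/mxrankS/row_subP => i; rewrite rowK.
have : tnth b i \in <<X>>%VS by apply/vbasis_mem/mem_tnth.
move=> /coord_span ->; apply/submxP.
exists (\row_j coord X j (tnth b i)); rewrite mulmx_sum_row.
by apply: eq_bigr => j _; rewrite rowK mxE [tnth X j](tnth_nth 0).
Qed.

Lemma vline_dim1 (F : fieldType) (V : vectType F) (W : {vspace V}) w :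
  \dim W = 1%N -> w \in W -> w != 0 -> W = <[w]>%VS.
Proof.
move=> W1 wW w0; apply/eqP; rewrite eq_sym eqEdim -memvE wW W1.
by rewrite dim_vline w0.
Qed.

Section FiniteSets.
Variables (F : fieldType) (d : nat).
Implicit Types (S : {fset 'rV[F]_d}) (p q x y : 'rV[F]_d).

(** For [p] in [S] this is the direction of the affine hull of [S]. *)
Definition span_from S p := <<[seq x - p | x <- enum_fset S]>>%VS.

Definition rich_neighbours S p : {fset 'rV[F]_d} :=
  [fset q in S | (q != p) &&
    `[< exists2 r, r \in S & [/\ r != p, r != q & r - p \in <[q - p]>%VS] >]]%fset.

Lemma dim_span_from_le S p : (\dim (span_from S p) <= #|` S|)%N.
Proof. by rewrite (leq_trans (dim_span _)) // size_map. Qed.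

Lemma mem_span_from S p x : x \in S -> x - p \in span_from S p.
Proof. by move=> xS; apply/memv_span/mapP; exists x. Qed.

End FiniteSets.

Lemma sylvester_gallai_dim (R : realType) d (S : {fset 'rV[R[i]]_d}) p (k : R) :
  0 < k -> (forall q, q \in S -> k <= #|` rich_neighbours S q|%:R) ->
  k ^+ 2 * (\dim (span_from S p))%:R <= 96 * (#|` S|)%:R ^+ 2.
Proof.
move=> k0 kS; pose s := in_tuple (enum_fset S).
have s_inj : injective (tnth s) by apply/tuple_uniqP/fset_uniq.
have sS i : tnth s i \in S by apply: mem_tnth.
apply: le_trans (sylvester_gallai_rank s_inj p k0 _).
  rewrite ler_wpM2l ?sqr_ge0 // ler_nat.
  have -> : span_from S p = <<map_tuple (fun x => x - p) s>>%VS by [].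
  rewrite (leq_trans (dim_span_le_rank _)) //.
  by under eq_mx => i j do rewrite tnth_map.
move=> i; apply: le_trans (kS _ (sS i)) _; rewrite ler_nat.
rewrite -(size_image (tnth s)); apply: uniq_leq_size; first exact: fset_uniq.
move=> q; rewrite !inE => /and3P[qS qp /asboolP[r rS [rp rq rpq]]].
have /tnthP[j ej] : q \in s by [].
have /tnthP[l el] : r \in s by [].
rewrite {}ej {}el in qp rp rq rpq *; apply/fintype.imageP; exists j => //.
rewrite inE (contraNneq _ qp) => [|->//].
apply/set0Pn; exists l; rewrite !inE rpq andbT.
by apply/andP; split; [apply: contraNneq rq => ->|apply: contraNneq rp => ->].
Qed.

(** * Consequences of the bichromatic condition *)

Section Bichromatic.
Variables (F : fieldType) (d : nat).
Implicit Types (V : {fset 'rV[F]_d}) (p q x y : 'rV[F]_d).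

Lemma on_bichromatic_linesC V1 V2 p V :
  on_bichromatic_lines V1 V2 p V = on_bichromatic_lines V2 V1 p V.
Proof.
apply/fsetP => x; rewrite !inE; congr (_ && _); apply/asboolP/asboolP;
  by move=> [L [[lL [u uV Lu] [v vV Lv]] Lp Lx]]; exists L; split=> //;
    split=> //; [exists v|exists u].
Qed.

Lemma on_bichromatic_linesP V1 V2 p V x : x \in on_bichromatic_lines V1 V2 p V ->
  x \in V /\ exists u v (W : {vspace 'rV[F]_d}), [/\ u \in V1, v \in V2,
    \dim W = 1%N & [/\ x - p \in W, u - p \in W & v - p \in W]].
Proof.
rewrite !inE => /andP[xV /asboolP[L [[[o [W [W1 ->]]] [u uV Lu] [v vV Lv]] Lp Lx]]].
split=> //; exists u, v, W; split=> //.
have sub z : flat o W z -> z - p \in W.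
  by move=> /memvB/(_ Lp); rewrite opprB addrA subrK.
by rewrite !sub.
Qed.

Lemma on_bichromatic_lines_sym V1 V2 V p x : p \in V ->
  x \in on_bichromatic_lines V1 V2 p V -> p \in on_bichromatic_lines V1 V2 x V.
Proof.
move=> pV; rewrite !inE => /andP[xV /asboolP[L [bL Lp Lx]]].
by rewrite pV; apply/asboolP; exists L.
Qed.

Lemma disjoint_neq V1 V2 x y : [disjoint V1 & V2]%fset ->
  x \in V1 -> y \in V2 -> x != y.
Proof.
by move=> /fdisjointP dV xV yV; apply: contraTneq yV => <-; apply: dV.
Qed.

(** The point of [V2] on the bichromatic line serves as third point; the successor accounts for [p]
    itself. *)
Lemma bichromatic_rich V1 V2 p : [disjoint V1 & V2]%fset -> p \in V1 ->
  (#|` on_bichromatic_lines V1 V2 p V1| <=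
   #|` rich_neighbours (V1 `|` V2)%fset p|.+1)%N.
Proof.
move=> dV pV; rewrite (cardfsD1 p) -[X in (_ <= X)%N]add1n.
apply: leq_add; first exact: leq_b1.
apply/fsubset_leq_card/fsubsetP => x; rewrite in_fsetD1 => /andP[xp].
move=> /on_bichromatic_linesP[xV [_ [v [W [_ vV W1 [xW _ vW]]]]]].
rewrite !inE xV xp /=; apply/asboolP; exists v; first by rewrite !inE vV orbT.
rewrite -(vline_dim1 W1 xW) ?subr_eq0 //.
by split=> //; rewrite eq_sym (disjoint_neq dV).
Qed.

(* A line through p with no third point of V1 meets V2, and distinct such lines
   meet V2 in distinct points. *)
Lemma bichromatic_rich_or_minority V1 V2 p : [disjoint V1 & V2]%fset -> p \in V1 ->
  (#|` on_bichromatic_lines V1 V2 p V1| <=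
   (#|` rich_neighbours V1 p| + #|` V2|).+1)%N.
Proof.
move=> dV pV; set B := on_bichromatic_lines _ _ _ _.
rewrite (cardfsD1 p) -[X in (_ <= X)%N]add1n.
apply: leq_add; first exact: leq_b1.
rewrite -(cardfsID (rich_neighbours V1 p)) leq_add //.
  by apply/fsubset_leq_card/fsubsetIr.
set D := (_ `\` _)%fset.
have DP x : x \in D -> exists v, v \in V2 /\
    [/\ x \in V1, x != p, x \notin rich_neighbours V1 p & <[v - p]>%VS = <[x - p]>%VS].
  rewrite in_fsetD in_fsetD1 => /and3P[xr xp].
  move=> /on_bichromatic_linesP[xV [_ [v [W [_ vV W1 [xW _ vW]]]]]].
  exists v; split=> //; split=> //.
  by rewrite -(vline_dim1 W1 xW) -?(vline_dim1 W1 vW) ?subr_eq0 // eq_sym (disjoint_neq dV).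
pose g x := xget p [set v | v \in V2 /\
    [/\ x \in V1, x != p, x \notin rich_neighbours V1 p & <[v - p]>%VS = <[x - p]>%VS]]%classic.
have gP x : x \in D -> g x \in V2 /\
    [/\ x \in V1, x != p, x \notin rich_neighbours V1 p & <[g x - p]>%VS = <[x - p]>%VS].
  by move=> /DP[v vP]; rewrite /g; case: xgetP => [z _ //|/(_ v)[]].
rewrite -(size_map g); apply: uniq_leq_size.
  (* Equal images put distinct [x] and [y] on one line through [p], so [y] would be a third point
     making [x] a rich neighbour. *)
  rewrite map_inj_in_uniq ?fset_uniq // => x y /gP[_ [xV xp xr xl]] /gP[_ [yV yp yr yl]] exy.
  apply/eqP; apply: contraNT xr => nxy; rewrite !inE xV xp; apply/asboolP.
  by exists y => //; split=> //; rewrite 1?eq_sym // -xl exy yl memv_line.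
by move=> _ /mapP[x /gP[gV _] ->].
Qed.

(* Modulo W, which contains V1 - p0, a bichromatic line becomes a line through
   the origin, so each vector added to W captures a whole set
   on_bichromatic_lines V1 V2 y V2 disjoint from the points captured before. *)
Lemma minority_span (R : realFieldType) V1 V2 p0 (W : {vspace 'rV[F]_d}) (c : R) :
  0 < c -> [disjoint V1 & V2]%fset -> (forall x, x \in V1 -> x - p0 \in W) ->
  (forall y, y \in V2 -> c <= #|` on_bichromatic_lines V1 V2 y V2|%:R) ->
  exists U : {vspace 'rV[F]_d}, [/\ (W <= U)%VS,
    forall y, y \in V2 -> y - p0 \in U &
    c * (\dim U)%:R <= c * (\dim W)%:R + #|` V2|%:R].
Proof.
move=> c0 dV V1W cV; pose out (U : {vspace 'rV[F]_d}) := [fset y in V2 | y - p0 \notin U]%fset.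
have step (U : {vspace 'rV[F]_d}) (y : 'rV[F]_d) :
    (W <= U)%VS -> y \in V2 -> y - p0 \notin U ->
    c + #|` out (U + <[y - p0]>)%VS|%:R <= #|` out U|%:R :> R.
  move=> WU yV yU; apply: le_trans (lerD (cV y yV) (lexx _)) _.
  rewrite -natrD ler_nat -cardfsUI.
  have capture x z : x \in V2 -> z \in on_bichromatic_lines V1 V2 x V2 ->
      z - p0 \in (U + <[x - p0]>)%VS.
    move=> xV /on_bichromatic_linesP[zV [u [_ [L [uV _ L1 [zL uL _]]]]]].
    have ux : u - x != 0 by rewrite subr_eq0 (disjoint_neq dV).
    move: zL; rewrite (vline_dim1 L1 uL ux) => /vlineP[t et].
    (* The point [z] lies on the line through [x] and a point [u] of [V1], and [u - p0] is already
       in [U]. *)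
    have -> : z - p0 = t *: (u - p0) + (1 - t) *: (x - p0).
      rewrite -[z](subrK x) et scalerBl scale1r addrCA -scalerBr opprB.
      by rewrite addrA subrK addrC addrA.
    by rewrite memv_add ?memvZ ?memv_line // (subvP WU) // V1W.
  set B := on_bichromatic_lines _ _ _ _.
  have -> : (B `&` out (U + <[y - p0]>)%VS)%fset = fset0.
    apply/eqP; rewrite -fsubset0; apply/fsubsetP => z; rewrite in_fsetI => /andP[zB].
    by rewrite !inE (capture _ _ yV zB) andbF.
  rewrite cardfs0 addn0; apply/fsubset_leq_card; rewrite fsubUset.
  apply/andP; split; apply/fsubsetP => z; last first.
    rewrite !inE => /andP[-> ]; apply: contra => zU.
    by rewrite (subvP (addvSl U _)).
  move=> zB; have [zV _] := on_bichromatic_linesP zB.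
  (* If [z - p0] were already in [U], then by symmetry [z] would capture [y] with nothing added to
     [U]. *)
  rewrite !inE zV; apply: contraNN yU => zU.
  have := capture _ _ zV (on_bichromatic_lines_sym yV zB).
  by rewrite (_ : (U + <[z - p0]>)%VS = U) //; apply/addv_idPl; rewrite -memvE.
(* The left side of this bound never increases: by [step], adding one vector removes at least [c]
   points from [out U] and raises the dimension by at most 1. *)
have : exists2 U : {vspace 'rV[F]_d}, (W <= U)%VS &
    c * (\dim U)%:R + #|` out U|%:R <= c * (\dim W)%:R + #|` V2|%:R.
  exists W; rewrite ?lerD2l ?ler_nat //.
  by apply/fsubset_leq_card/fsubsetP => z; rewrite !inE => /andP[].
case=> U; have [m] := ubnP #|` out U|; elim: m U => // m IHm U ltm WU le_U.
have [out0|[y]] := fset_0Vmem (out U).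
  exists U; split=> // [y yV|].
    by apply: contraT => yU; have := in_fset0 y; rewrite -out0 !inE yV yU.
  by apply: le_trans le_U; rewrite lerDl.
rewrite !inE => /andP[yV yU]; have stepU := step U y WU yV yU.
apply: (IHm (U + <[y - p0]>)%VS).
- apply: leq_trans (_ : #|` out U| <= m)%N; last by rewrite -ltnS.
  rewrite -(ltr_nat R).
  by apply: lt_le_trans stepU; rewrite ltrDr.
- exact: subv_trans WU (addvSl _ _).
- apply: le_trans le_U.
  have : (\dim (U + <[y - p0]>) <= \dim U + 1)%N.
    by rewrite (leq_trans (dimv_add_leqif _ _)) // leq_add2l dim_vline leq_b1.
  rewrite -(ler_nat R) natrD => /(ler_wpM2l (ltW c0)); lra.
Qed.
End Bichromatic.

(** * The balanced and unbalanced cases, and the final bound *)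

Section Main.
Variables (R : realType) (d : nat).
Implicit Types (V : {fset 'rV[R[i]]_d}).

Lemma MR_configurationC (delta : R) V1 V2 :
  MR_configuration delta V1 V2 -> MR_configuration delta V2 V1.
Proof.
case=> dV h1 h2; split; first by rewrite fdisjoint_sym.
  by move=> p pV; rewrite on_bichromatic_linesC; apply: h2.
by move=> p pV; rewrite on_bichromatic_linesC; apply: h1.
Qed.

(** A smallest flat, if one exists, lies in a single point, so its direction is zero; otherwise the
    default value is zero. *)
Lemma affine_dim_fset0 (F : fieldType) n :
  affine_dim [set` (fset0 : {fset 'rV[F]_n})]%classic = 0%N.
Proof.
rewrite /affine_dim; case: xgetP => [W _ [p [_ sub]]|_]; last exact: dimv0.
have {}sub : (flat p W `<=` flat p 0%VS)%classic by apply: sub => x; rewrite /= inE.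
apply/eqP; rewrite dimv_eq0 -subv0; apply/subvP => w wW.
by have := sub (w + p); rewrite /flat /= addrK; apply.
Qed.

Lemma card_union_le V1 V2 : (#|` (V1 `|` V2)%fset| <= #|` V1| + #|` V2|)%N.
Proof. by rewrite cardfsU leq_subr. Qed.

(** The union has at most [5 * n2 / delta] points while [k] is of order [delta * n2]; the squared
    ratio gives the exponent 4. *)
Lemma MR_dim_balanced (delta : R) V1 V2 p :
  0 < delta -> delta <= 1 -> MR_configuration delta V1 V2 ->
  (#|` V2| <= #|` V1|)%N -> delta / 4 * #|` V1|%:R <= #|` V2|%:R ->
  (\dim (span_from (V1 `|` V2)%fset p))%:R * delta ^+ 4 <= 10000.
Proof.
move=> d0 d1 [dV h1 h2]; rewrite -(ler_nat R) => n21 bal.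
set D : R := _%:R; set n1 : R := #|` V1|%:R in n21 bal *.
set n2 : R := #|` V2|%:R in n21 bal *.
have D_ge0 : 0 <= D by apply: ler0n.
have leS : #|` (V1 `|` V2)%fset|%:R <= n1 + n2 :> R by rewrite -natrD ler_nat card_union_le.
have n_le : delta * (n1 + n2) <= 5 * n2.
  have : delta * n2 <= n2 by rewrite ler_piMl ?ler0n.
  lra.
(* For [delta * n2 < 2], counting points suffices; otherwise half of [delta * n2] absorbs the loss
   of 1 in [bichromatic_rich]. *)
have [small|big] := ltrP (delta * n2) 2.
  have Dn : D <= n1 + n2 by apply: le_trans leS; rewrite ler_nat dim_span_from_le.
  have : D * delta ^+ 4 <= D * delta ^+ 2.
    by rewrite ler_wpM2l // ler_wiXn2l // ltW.
  have : D * delta ^+ 2 <= delta * (delta * (n1 + n2)).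
    by rewrite mulrA -expr2 mulrC ler_wpM2l // sqr_ge0.
  have : delta * (delta * (n1 + n2)) <= delta * (5 * n2) by rewrite ler_wpM2l // ltW.
  lra.
pose k := delta * n2 / 2.
have k0 : 0 < k by rewrite /k; lra.
have rich q : q \in (V1 `|` V2)%fset -> k <= #|` rich_neighbours (V1 `|` V2)%fset q|%:R.
  rewrite !inE => /orP[qV|qV].
    have := bichromatic_rich dV qV; rewrite -(ler_nat R) -natr1.
    have := h1 q qV; have := ler_wpM2l (ltW d0) n21; rewrite /k -/n1; lra.
  have := dV; rewrite fdisjoint_sym => /bichromatic_rich/(_ qV).
  rewrite fsetUC on_bichromatic_linesC -(ler_nat R) -natr1.
  have := h2 q qV; rewrite /k -/n2; lra.
have := sylvester_gallai_dim p k0 rich; rewrite -/D => le1.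
have le2 : #|` (V1 `|` V2)%fset|%:R ^+ 2 * delta ^+ 2 <= (5 * n2) ^+ 2.
  rewrite -exprMn; apply: lerXn2r; rewrite ?nnegrE ?mulr_ge0 ?ler0n ?(ltW d0) //.
  by apply: le_trans n_le; rewrite mulrC ler_wpM2l // ltW.
have n2_gt0 : 0 < n2 by rewrite -(pmulr_rgt0 _ d0); lra.
rewrite -(ler_pM2l (exprn_gt0 2 n2_gt0)).
have := ler_wpM2r (sqr_ge0 delta) le1.
have -> : k ^+ 2 * D * delta ^+ 2 = n2 ^+ 2 * (D * delta ^+ 4) / 4 by rewrite /k; field.
have := sqr_ge0 n2; rewrite exprMn in le2; lra.
Qed.

(** The set [V1] alone spans dimension at most [384 / delta ^ 2], and [minority_span] with
    [c = delta * n2] adds at most [1 / delta]. *)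
Lemma MR_dim_unbalanced (delta : R) V1 V2 p : p \in V1 ->
  0 < delta -> delta <= 1 -> MR_configuration delta V1 V2 ->
  #|` V2|%:R <= delta / 4 * #|` V1|%:R ->
  (\dim (span_from (V1 `|` V2)%fset p))%:R * delta ^+ 4 <= 10000.
Proof.
move=> pV1 d0 d1 [dV h1 h2] unb.
set D : R := _%:R; set n1 : R := #|` V1|%:R in unb *; set n2 : R := #|` V2|%:R in unb *.
have D_ge0 : 0 <= D by apply: ler0n.
have n1_gt0 : 0 < n1 by rewrite ltr0n cardfs_gt0; apply/fset0Pn; exists p.
have n2_gt0 : 0 < n2.
  have : 0 < #|` on_bichromatic_lines V1 V2 p V1|%:R :> R.
    by apply: lt_le_trans (h1 p pV1); rewrite mulr_gt0.
  rewrite !ltr0n !cardfs_gt0 => /fset0Pn[x /on_bichromatic_linesP[_ [_ [v [_ [_ vV _ _]]]]]].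
  by apply/fset0Pn; exists v.
have dn2 : 0 < delta * n2 by rewrite mulr_gt0.
have big : 4 <= delta * n1.
  have : 1 <= n2 by rewrite ler1n -(ltr0n R).
  lra.
(* The losses 1 and [n2] in [bichromatic_rich_or_minority] are each at most a quarter of
   [delta * n1]. *)
pose k := delta * n1 / 2.
have k0 : 0 < k by rewrite /k; lra.
have rich q : q \in V1 -> k <= #|` rich_neighbours V1 q|%:R.
  move=> qV; have := bichromatic_rich_or_minority dV qV.
  rewrite -(ler_nat R) -natr1 natrD; have := h1 q qV; rewrite /k -/n1 -/n2; lra.
have := sylvester_gallai_dim p k0 rich; set D1 : R := (\dim _)%:R => le1.
have {}le1 : D1 * delta ^+ 2 <= 384.
  rewrite -(ler_pM2l (exprn_gt0 2 n1_gt0)); move: le1; rewrite -/n1.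
  have -> : k ^+ 2 * D1 = n1 ^+ 2 * (D1 * delta ^+ 2) / 4 by rewrite /k; field.
  lra.
have [U [WU V2U leU]] := minority_span dn2 dV (mem_span_from p (S:=V1)) h2.
have DU : D <= (\dim U)%:R.
  rewrite ler_nat; apply/dimvS/span_subvP => _ /mapP[x + ->].
  by rewrite !inE => /orP[xV|/V2U//]; rewrite (subvP WU) // mem_span_from.
have {}leU : delta * (\dim U)%:R <= delta * D1 + 1.
  by rewrite -(ler_pM2l n2_gt0); move: leU; rewrite -/n2; lra.
have : delta * D <= delta * (\dim U)%:R by rewrite ler_wpM2l // ltW.
move=> /le_trans/(_ leU)/(ler_wpM2l (ltW d0)).
have : D * delta ^+ 4 <= D * delta ^+ 2 by rewrite ler_wpM2l // ler_wiXn2l // ltW.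
by rewrite !expr2 in le1 *; lra.
Qed.

End Main.

Theorem theorem6p2 (R : realType) :
  exists C : R, 0 < C /\
    forall (d : nat) (delta : R) (V1 V2 : {fset 'rV[R[i]]_d}),
      0 < delta -> delta <= 1 ->
      MR_configuration delta V1 V2 ->
      (affine_dim [set` (V1 `|` V2)%fset]%classic)%:R <= C / delta ^+ 4.
Proof.
(* The balanced case needs at most [4 * 96 * 25 = 9600], the unbalanced one at most 385. *)
exists 10000; split=> // d delta V1 V2 d0 d1.
wlog le21 : V1 V2 / (#|` V2| <= #|` V1|)%N.
  move=> wl MR; have [|/ltnW] := leqP #|` V2| #|` V1|; first by move/wl; apply.
  by move/wl; rewrite fsetUC; apply; apply: MR_configurationC.
move=> MR; rewrite ler_pdivlMr ?exprn_gt0 //.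
have [V10|[p pV1]] := fset_0Vmem V1.
  move: le21; rewrite V10 cardfs0 leqn0 cardfs_eq0 => /eqP ->.
  by rewrite fsetUid affine_dim_fset0 mul0r.
have pV : p \in (V1 `|` V2)%fset by rewrite inE pV1.
rewrite (affine_dimE pV).
have [bal|/ltW unb] := lerP (delta / 4 * #|` V1|%:R) #|` V2|%:R.
  exact: MR_dim_balanced.
exact: MR_dim_unbalanced.
Qed.
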